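(* The flattened Takagi function $\tau^L$ is of bounded (pointwise) variation on $(0,1)$. It has a minimal monotone decomposition given by $$\tau^L(x)=f_u(x)+f_d(x),$$ with downward (nonincreasing) part $f_d(x)=-x$ and upward (nondecreasing) part $f_u(x)=\tau^L(x)+x$, both being continuous functions. The upward part $f_u$ is a singular function (its derivative is zero Lebesgue almost everywhere) whose points of increase are supported on the deficient digit set $\Omega^L$ (i.e. all its points of increase lie in $\Omega^L$). The total variation of the flattened Takagi function is $V_0^1(\tau^L)=2$, with $V_0^1(f_u)=V_0^1(f_d)=1$.
   Context: The Takagi function is $\tau(x)=\sum_{n=0}^\infty 2^{-n}\operatorname{dist}(2^n x,\mathbb{Z})$ for $x\in[0,1]$, where $\operatorname{dist}(t,\mathbb{Z})=\inf_{m\in\mathbb{Z}}|t-m|$. For a binary expansion $x=0.b_1b_2\ldots=\sum_{j\ge1}b_j2^{-j}$, $b_j\in\{0,1\}$, put $D_j(x)=j-2(b_1+\cdots+b_j)$ for $j\ge1$. The deficient digit set $\Omega^L$ is the set of all $x\in[0,1]$ having a binary expansion with $D_j(x)\ge0$ for all $j\ge1$. It is a closed set containing $0$. For $x\in[0,1]$ let $P^L(x)$ be the largest point of $\Omega^L$ that is $\le x$. The flattened Takagi function is $\tau^L(x)=\tau(P^L(x))+P^L(x)-x$ for $x\in[0,1]$. For a function $f$ on $(0,1)$, the total variation is $V_0^1(f)=\sup\{\sum_{i=1}^n|f(x_i)-f(x_{i-1})|: 0<x_0<x_1<\cdots<x_n<1,\ n\ge1\}$, and $f$ is of bounded (pointwise)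 variation if this is finite. A monotone decomposition is $f=f_u+f_d$ with $f_u$ bounded nondecreasing and $f_d$ bounded nonincreasing; it is minimal if $V_0^1(f)=V_0^1(f_u)+V_0^1(f_d)$. A point $x\in(0,1)$ is a point of increase of a nondecreasing function $f$ on $[0,1]$ if $f(x')<f(x)<f(x'')$ for all $x',x''\in[0,1]$ with $x'<x<x''$. *)

(* Defs.v *)
From HB Require Import structures.
From mathcomp Require Import all_boot all_order all_algebra.
From mathcomp Require Import all_classical all_reals all_analysis.

Set Implicit Arguments.
Unset Strict Implicit.
Unset Printing Implicit Defensive.

Import Order.TTheory GRing.Theory Num.Theory.
Import numFieldNormedType.Exports.

Local Open Scope classical_set_scope.
Local Open Scope ring_scope.

Definition distZ {R : realType} (t : R) : R :=
  inf [set `|t - m%:~R| | m in [set: int]].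

Definition takagi {R : realType} (x : R) : R :=
  limn (series (fun n => 2 ^- n * distZ (2 ^+ n * x))).

(* Digits are indexed from 0: [b j] is the (j+1)-st binary digit. *)
Definition binary_expansion {R : realType} (b : nat -> bool) (x : R) : Prop :=
  series (fun j => (b j)%:R * 2 ^- j.+1) @ \oo --> x.

Definition digit_deficit (b : nat -> bool) (j : nat) : int :=
  j%:Z - 2 * (\sum_(i < j) b i)%N%:Z.

Definition OmegaL {R : realType} : set R :=
  [set x | x \in `[0, 1] /\ exists b : nat -> bool,
     binary_expansion b x /\ forall j, (1 <= j)%N -> 0 <= digit_deficit b j].

(* The largest point of OmegaL that is <= x; it exists for x in [0, 1] since
   OmegaL is closed and contains 0, so the default value 0 plays no role. *)
Definition PL {R : realType} (x : R) : R :=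
  xget 0 [set y | [/\ OmegaL y, y <= x & forall z, OmegaL z -> z <= x -> z <= y]].

Definition takagiL {R : realType} (x : R) : R := takagi (PL x) + PL x - x.

(* The library's [total_variation] is on the closed interval [a, b]; here only
   partition points in the open interval are used: x0 is the first partition
   point, xn the last one, and s lists the points after x0 (up to xn). *)
Definition open_total_variation {R : realType} (a b : R) (f : R -> R) : \bar R :=
  ereal_sup [set v | exists x0 xn s,
    [/\ a < x0, x0 < xn, xn < b, itv_partition x0 xn s
      & v = (variation x0 xn f s)%:E]].

Definition open_bounded_variation {R : realType} (a b : R) (f : R -> R) : Prop :=
  (open_total_variation a b f < +oo)%E.

Definition monotone_decomposition {R : realType} (a b : R) (f fu fd : R -> R) :
    Prop :=
  [/\ {in `]a, b[, forall x, f x = fu x + fd x},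
      [bounded fu x | x in `]a, b[%classic],
      {in `]a, b[ &, nondecreasing_fun fu},
      [bounded fd x | x in `]a, b[%classic]
    & {in `]a, b[ &, nonincreasing_fun fd}].

Definition minimal_monotone_decomposition {R : realType} (a b : R)
    (f fu fd : R -> R) : Prop :=
  monotone_decomposition a b f fu fd /\
  open_total_variation a b f =
    (open_total_variation a b fu + open_total_variation a b fd)%E.

Definition singular_on {R : realType} (a b : R) (f : R -> R) : Prop :=
  {ae lebesgue_measure, forall x : R, a < x < b -> is_derive x 1 f 0}.

Definition point_of_increase {R : realType} (f : R -> R) (x : R) : Prop :=
  0 < x < 1 /\
  forall x' x'' : R, x' \in `[0, 1] -> x'' \in `[0, 1] -> x' < x -> x < x'' ->
    f x' < f x /\ f x < f x''.

(* Main.v *)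
Require Import Defs.
From HB Require Import structures.
From mathcomp Require Import all_boot all_order all_algebra.
From mathcomp Require Import all_classical all_reals all_analysis.
From mathcomp Require Import ring lra zify.
Import Order.TTheory GRing.Theory Num.Theory.
Import numFieldNormedType.Exports.
Local Open Scope classical_set_scope.
Local Open Scope ring_scope.

(** Reading the binary digits of [x] as steps of a walk on the naturals, digit
    0 up and digit 1 down, the deficient digit set consists of the points whose
    walk, started at height 1, never reaches 0.  For every starting height [d]
    the simple random walk conditioned to stay positive (the Doob transform by
    the harmonic function [d |-> d]) gives a measure of total mass [d] on the
    points of [0, 1] with a surviving walk.  Its distribution function [cdf d] is
    characterised by the self-similarity

      cdf d x = (cdf (d + 1) (2 x) + cdf (d - 1) (2 x - 1)) / 2,   cdf 0 = 0,

    together with [cdf d = 0] left of 0 and [cdf d = d] right of 1 (lemma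
    [cdfS]).  The key identity is [takagiL_cdf]: the upward part
    [takagiL x + x] is [cdf 1 x].

    It holds because the Takagi function satisfies the same self-similarity as
    [cdf d x - d x] along surviving walks, so [cdf d x = d x + takagi x] there
    ([cdf_takagi]), while [cdf d] has derivative zero off the set of survivors
    ([is_derive_cdf]), hence is constant between [PL x] and [x] ([cdf_PL]).

    Everything else is read off [cdf].  It is nondecreasing and continuous, as a
    uniform limit of such functions.  It is singular because the survivors are
    the intersection of dyadic covers [cover n d] whose total length
    [survival n d] is the probability that the walk survives [n] steps; the
    limit of these probabilities is harmonic at heights [d > 0] and vanishes at
    0, so it is linear in [d], and being bounded it vanishes ([survival_cvg0]).

    The same probability bounds the sum over the dyadic grid of the minima of an
    increment of [cdf 1] and the mesh ([sum_inc_min]).  Since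
    [|a - b| = a + b - 2 min(a, b)], the variation of [cdf 1 x - x] on the grid
    is then arbitrarily close to 2; by the triangle inequality it cannot exceed
    the sum of the variations of the two monotone parts, which is 2 as well. *)

(** * The distribution function of the conditioned walk *)
Section conditioned_walk.
Local Set Implicit Arguments.
Local Unset Strict Implicit.
Local Unset Printing Implicit Defensive.
Context {R : realType}.
Implicit Types (x y : R) (n d : nat).

(** Distribution function of the uniform measure on [0, 1]. *)
Definition clamp x : R := Num.max 0 (Num.min 1 x).

Lemma clamp_ge1 x : 1 <= x -> clamp x = 1.
Proof.
move=> x1; rewrite /clamp.
by case: (leP 1 x) => [_|]; [rewrite max_r | rewrite ltNge x1].
Qed.

Lemma clamp_le0 x : x <= 0 -> clamp x = 0.
Proof.
move=> x0; rewrite /clamp; case: (leP 1 x) => [x1|_]; last by rewrite max_l.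
by have := le_trans x1 x0; rewrite ler10.
Qed.

Lemma clamp_id x : 0 <= x <= 1 -> clamp x = x.
Proof. by move=> /andP[x0 x1]; rewrite /clamp min_r// max_r. Qed.

Lemma clamp_homo : {homo clamp : x y / x <= y}.
Proof.
have range x : 0 <= clamp x <= 1.
  have [x0|x0] := leP x 0; first by rewrite clamp_le0// lexx ler01.
  have [x1|x1] := leP 1 x; first by rewrite clamp_ge1// lexx ler01.
  by rewrite clamp_id; lra.
move=> x y xy.
have [x0|x0] := leP x 0; first by rewrite (clamp_le0 x0); have := range y; lra.
have [y1|y1] := leP 1 y; first by rewrite (clamp_ge1 y1); have := range x; lra.
by rewrite !clamp_id; lra.
Qed.

Lemma continuous_clamp : continuous clamp.
Proof.
move=> x; apply: continuous_max; first exact: cst_continuous.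
by apply: continuous_min; [exact: cst_continuous | exact: id].
Qed.

Lemma pow_half_cvg0 : (fun n => 2 ^- n : R) @ \oo --> (0 : R).
Proof.
under eq_fun do rewrite -exprVn.
by apply: cvg_expr; rewrite ger0_norm ?invr_ge0//; lra.
Qed.

(** Distribution function of the density obtained by conditioning on the first
    [n] digits only: mass [d] is spread uniformly at level 0, and each step
    halves the interval and sends the walk up on the left and down on the right.
    Height 0 is absorbing and carries no mass.  Since each function is constant
    outside [0, 1], adding the two rescaled copies needs no case distinction on
    the half that contains [x]. *)
Fixpoint cdfn n d x : R :=
  match d, n with
  | 0%N, _ => 0
  | d'.+1, 0%N => d%:R * clamp x
  | d'.+1, n'.+1 => (cdfn n' d.+1 (2 * x) + cdfn n' d' (2 * x - 1)) / 2
  end.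

Lemma cdfn0 n x : cdfn n 0 x = 0.
Proof. by case: n. Qed.

Lemma cdfnS n d x : cdfn n.+1 d.+1 x =
  (cdfn n d.+2 (2 * x) + cdfn n d (2 * x - 1)) / 2.
Proof. by []. Qed.

Lemma cdfn_le0 n d x : x <= 0 -> cdfn n d x = 0.
Proof.
elim: n d x => [|n IH] [|d] x x0 //=; first by rewrite clamp_le0// mulr0.
by rewrite !IH ?addr0 ?mul0r//; lra.
Qed.

Lemma cdfn_ge1 n d x : 1 <= x -> cdfn n d x = d%:R.
Proof.
elim: n d x => [|n IH] [|d] x x1 //=; first by rewrite clamp_ge1// mulr1.
have [x2 x21] : 1 <= 2 * x /\ 1 <= 2 * x - 1 by split; lra.
by rewrite !IH// -(natr1 d.+1) -(natr1 d); lra.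
Qed.

Lemma cdfn_homo n d : {homo cdfn n d : x y / x <= y}.
Proof.
elim: n d => [|n IH] [|d] x y xy //=.
  by apply: ler_wpM2l => //; exact: clamp_homo.
by rewrite ler_pM2r ?invr_gt0//; apply: lerD; apply: IH; lra.
Qed.

Lemma continuous_cdfn n d : continuous (cdfn n d).
Proof.
elim: n d => [|n IH] [|d] x /=; try exact: cst_continuous.
  by apply: cvgM; [exact: cvg_cst | exact: continuous_clamp].
have left_half : continuous (fun y : R => cdfn n d.+2 (2 * y)).
  move=> y.
  apply: (@continuous_comp _ _ _ (fun y : R => 2 * y)); last exact: IH.
  exact: mulrl_continuous.
have right_half : continuous (fun y : R => cdfn n d (2 * y - 1)).
  move=> y.
  apply: (@continuous_comp _ _ _ (fun y : R => 2 * y - 1)); last exact: IH.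
  by apply: cvgB; [exact: mulrl_continuous | exact: cvg_cst].
apply: cvgM; last exact: cvg_cst.
by apply: cvgD; [exact: left_half | exact: right_half].
Qed.

(** Level 0 and level 1 differ only by moving mass within [0, 1], by at most 1/2;
    self-similarity halves this bound at each further level, because only one of
    the two rescaled copies varies near [x]. *)
Lemma cdfn_step n d x : 0 <= cdfn n.+1 d x - cdfn n d x <= 2 ^- n.+1.
Proof.
elim: n d x => [|n IH] [|d] x;
  try by rewrite !cdfn0 subrr lexx invr_ge0 exprn_ge0.
  rewrite cdfnS expr1.
  have cE k y : cdfn 0 k y = k%:R * clamp y by case: k => //; rewrite mul0r.
  rewrite !cE -(natr1 d.+1) -(natr1 d).
  have [x0|x0] := leP x 0; first by rewrite !clamp_le0; lra.
  have [x1|x1] := leP 1 x; first by rewrite !clamp_ge1; lra.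
  have xE : clamp x = x by apply: clamp_id; lra.
  rewrite xE.
  have d0 : 0 <= d%:R :> R by [].
  have [xh|xh] := leP x 2^-1.
    by rewrite (@clamp_id (2 * x)) ?(@clamp_le0 (2 * x - 1)); lra.
  by rewrite (@clamp_ge1 (2 * x)) ?(@clamp_id (2 * x - 1)); lra.
rewrite !(cdfnS _ d).
have e2 : (2:R) ^- n.+2 = 2 ^- n.+1 / 2 by rewrite exprSr invfM.
have p2 : 0 <= (2:R) ^- n.+1 by rewrite invr_ge0 exprn_ge0.
have [xh|xh] := leP x 2^-1.
  by rewrite ?(@cdfn_le0 _ _ (2 * x - 1)); have := IH d.+2 (2 * x); lra.
by rewrite ?(@cdfn_ge1 _ _ (2 * x)); have := IH d (2 * x - 1); lra.
Qed.

Lemma cdfn_nondecreasing d x : nondecreasing_seq (fun n => cdfn n d x).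
Proof. by apply/nondecreasing_seqP => n; have := cdfn_step n d x; lra. Qed.

(** Together with [cdfn_nondecreasing] this traps the limit between [cdfn n d x]
    and [cdfn n d x + 2 ^- n], hence the uniform rate of [cdf_dist]. *)
Lemma cdfn_nonincreasing d x : nonincreasing_seq (fun n => cdfn n d x + 2 ^- n).
Proof.
apply/nonincreasing_seqP => n; have := cdfn_step n d x.
by rewrite exprSr invfM; lra.
Qed.

Definition cdf d x := limn (fun n => cdfn n d x).

Lemma cdfn_itv n d x : 0 <= cdfn n d x <= d%:R.
Proof.
have [x0|x0] := leP x 0; first by rewrite cdfn_le0// lexx ler0n.
have [x1|x1] := leP 1 x; first by rewrite cdfn_ge1// lexx ler0n.
by rewrite -[leLHS](@cdfn_le0 n d 0)// -(@cdfn_ge1 n d 1)// !cdfn_homo// ltW.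
Qed.

Lemma is_cvg_cdfn d x : cvgn (fun n => cdfn n d x).
Proof.
apply: nondecreasing_is_cvgn; first exact: cdfn_nondecreasing.
by exists d%:R => _ [n _ <-]; have /andP[] := cdfn_itv n d x.
Qed.

Lemma cdfn_cvg d x : (fun n => cdfn n d x) @ \oo --> cdf d x.
Proof. exact: is_cvg_cdfn. Qed.

Lemma cdf_dist n d x : `|cdf d x - cdfn n d x| <= 2 ^- n.
Proof.
have lb : cdfn n d x <= cdf d x.
  apply: (@nondecreasing_cvgn_le _ (fun m => cdfn m d x)).
    exact: cdfn_nondecreasing.
  exact: is_cvg_cdfn.
rewrite ger0_norm ?subr_ge0// lerBlDr addrC.
apply: limr_le; first exact: is_cvg_cdfn.
near=> m; have nm : (n <= m)%N by near: m; exact: nbhs_infty_ge.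
have /= := @cdfn_nonincreasing d x _ _ nm.
have : 0 <= (2 : R) ^- m by rewrite invr_ge0 exprn_ge0.
lra.
Unshelve. all: by end_near. Qed.

Lemma cdf0 x : cdf 0 x = 0.
Proof.
by apply/cvg_lim => //; under eq_fun do rewrite cdfn0; exact: cvg_cst.
Qed.

Lemma cdfS d x : cdf d.+1 x = (cdf d.+2 (2 * x) + cdf d (2 * x - 1)) / 2.
Proof.
apply/cvg_lim => //; rewrite -cvg_shiftS/=.
by apply: cvgM; [apply: cvgD; exact: cdfn_cvg | exact: cvg_cst].
Qed.

Lemma cdf_le0 d x : x <= 0 -> cdf d x = 0.
Proof.
move=> x0; apply/cvg_lim => //; under eq_fun do rewrite cdfn_le0//.
exact: cvg_cst.
Qed.

Lemma cdf_ge1 d x : 1 <= x -> cdf d x = d%:R.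
Proof.
move=> x1; apply/cvg_lim => //; under eq_fun do rewrite cdfn_ge1//.
exact: cvg_cst.
Qed.

Lemma cdf_homo d : {homo cdf d : x y / x <= y}.
Proof.
move=> x y xy; apply: ler_lim; [exact: is_cvg_cdfn | exact: is_cvg_cdfn |].
by near=> n; exact: cdfn_homo.
Unshelve. all: by end_near. Qed.

Lemma cdf_itv d x : 0 <= cdf d x <= d%:R.
Proof.
apply/andP; split.
  apply: limr_ge; first exact: is_cvg_cdfn.
  by near=> n; have /andP[] := cdfn_itv n d x.
apply: limr_le; first exact: is_cvg_cdfn.
by near=> n; have /andP[] := cdfn_itv n d x.
Unshelve. all: by end_near. Qed.

Lemma continuous_cdf d : continuous (cdf d).
Proof.
move=> x; apply/cvgrPdist_lt => e e0.
have e3 : 0 < e / 3 by lra.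
have [N _ /(_ N (leqnn N)) /=] := cvgr_lt _ pow_half_cvg0 _ e3.
move: N => n ne.
have /cvgrPdist_lt/(_ _ e3) := @continuous_cdfn n d x.
apply: filterS => y; have := cdf_dist n d x; have := cdf_dist n d y.
rewrite !ltr_norml !ler_norml; lra.
Qed.

End conditioned_walk.

(** * Dyadic covers of the surviving points *)
Section dyadic_covers.
Context {R : realType}.
Local Set Implicit Arguments.
Local Unset Strict Implicit.
Local Unset Printing Implicit Defensive.
Implicit Types (x y : R) (n d : nat).

(** The union of the closed dyadic intervals of length [2 ^- n] along which the
    walk started at [d] survives [n] steps.  Taking closed intervals allows both
    expansions of a dyadic point. *)
Fixpoint cover n d : set R :=
  match d, n with
  | 0%N, _ => set0
  | _.+1, 0%N => `[0, 1]
  | d'.+1, n'.+1 => [set x | cover n' d.+1 (2 * x) \/ cover n' d' (2 * x - 1)]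
  end.

Lemma cover0 n x : ~ cover n 0 x.
Proof. by case: n => [|n] []. Qed.

Lemma coverS n d x : cover n.+1 d.+1 x <->
  cover n d.+2 (2 * x) \/ cover n d (2 * x - 1).
Proof. by []. Qed.

Lemma cover0S d x : cover 0 d.+1 x <-> 0 <= x <= 1.
Proof. by rewrite /cover /= in_itv. Qed.

Lemma cover_itv n d x : cover n d x -> 0 <= x <= 1.
Proof.
elim: n d x => [|n IH] [|d] x; try by move/cover0.
  by move/cover0S.
by move=> /coverS[] /IH; lra.
Qed.

Lemma coverS_subset n d : cover n.+1 d `<=` cover n d.
Proof.
elim: n d => [|n IH] [|d] x; try by move/cover0.
  by move=> /cover_itv h; apply/cover0S.
by move=> /coverS[] /IH h; apply/coverS; [left | right].
Qed.

Lemma cover_le m n d : (m <= n)%N -> cover n d `<=` cover m d.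
Proof.
move=> /subnKC <-; elim: (n - m)%N => [|k IH]; first by rewrite addn0.
by rewrite addnS => x /coverS_subset/IH.
Qed.

Lemma closed_cover n d : closed (cover n d).
Proof.
elim: n d => [|n IH] [|d]; try exact: closed0; first exact: interval_closed.
have half_cont c : continuous (fun x : R => 2 * x - c).
  by move=> x; apply: cvgB; [exact: mulrl_continuous | exact: cvg_cst].
have /continuous_closedP cl0 := half_cont 0.
have /continuous_closedP cl1 := half_cont 1.
have -> : cover n.+1 d.+1 = (fun x => 2 * x - 0) @^-1` cover n d.+2 `|`
    (fun x => 2 * x - 1) @^-1` cover n d.
  by apply/seteqP; split=> x; rewrite /= subr0.
by apply: closedU; [apply: cl0 | apply: cl1]; exact: IH.
Qed.

(** Off a cover the walk has been absorbed or the point lies outside the unit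
    interval, so no mass is left near [x]. *)
Lemma is_derive_cdf n d x : ~ cover n d x -> is_derive x 1 (cdf d) 0.
Proof.
have flat (f : R -> R) c y : (\forall z \near y, f z = c) -> is_derive y 1 f 0.
  move=> fc; apply: near_eq_is_derive (is_derive_cst c _ _).
  by near=> z; apply/esym; near: z.
elim: n d x => [|n IH] [|d] x nx.
- by apply: (flat _ 0); near=> y; rewrite cdf0.
- have /orP[x0|x1] : (x < 0) || (1 < x).
  + apply/negPn/negP; rewrite negb_or -!leNgt => x01; exact/nx/cover0S.
  + apply: (flat _ 0); apply: filterS (lt_nbhsl x0) => y y0; exact/cdf_le0/ltW.
  + apply: (flat _ d.+1%:R); apply: filterS (lt_nbhsr x1) => y y1.
    exact/cdf_ge1/ltW.
- by apply: (flat _ 0); near=> y; rewrite cdf0.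
- have half c : is_derive x 1 (fun y : R => 2 * y - c) 2.
    have -> : (fun y : R => 2 * y - c) = 2 *: (id : R -> R) - cst c by [].
    by apply: is_derive_eq; rewrite subr0 scaler1.
  have left_half : is_derive x 1 (cdf d.+2 \o (fun y => 2 * y - 0)) (0 * 2).
    apply: (is_derive1_comp _ (half 0)); apply: IH => h; apply/nx/coverS; left.
    by rewrite subr0 in h.
  have right_half : is_derive x 1 (cdf d \o (fun y => 2 * y - 1)) (0 * 2).
    apply: (is_derive1_comp _ (half 1)); apply: IH => h; apply/nx/coverS.
    by right.
  have -> : cdf d.+1 = 2^-1 *: ((cdf d.+2 \o (fun y => 2 * y - 0)) +
      (cdf d \o (fun y => 2 * y - 1))) :> (R -> R).
    by apply/funext => y; rewrite cdfS mulrC -{1}[2 * y]subr0.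
  by apply: is_derive_eq; rewrite mul0r addr0 scaler0.
Unshelve. all: by end_near. Qed.

(** The probability that the simple random walk started at [d] does not hit 0
    within [n] steps. *)
Fixpoint survival n d : R :=
  match d, n with
  | 0%N, _ => 0
  | _.+1, 0%N => 1
  | d'.+1, n'.+1 => (survival n' d.+1 + survival n' d') / 2
  end.

Lemma survival0 n : survival n 0 = 0.
Proof. by case: n. Qed.

Lemma survivalS n d :
  survival n.+1 d.+1 = (survival n d.+2 + survival n d) / 2.
Proof. by []. Qed.

Lemma survival_itv n d : 0 <= survival n d <= 1.
Proof.
elim: n d => [|n IH] [|d] /=; try by rewrite lexx ler01.
by have := IH d.+2; have := IH d; lra.
Qed.

Lemma survival_decr n d : survival n.+1 d <= survival n d.
Proof.
elim: n d => [|n IH] [|d]; rewrite ?survival0//.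
  by have /andP[] := survival_itv 1 d.+1.
by rewrite !(survivalS _ d); have := IH d.+2; have := IH d; lra.
Qed.

(** The limit [M d] satisfies [M 0 = 0] and [M (d + 1) = (M (d + 2) + M d) / 2],
    so [M d = d * M 1]; boundedness by 1 for every [d] forces [M 1 = 0]. *)
Lemma survival_cvg0 : (fun n => survival n 1) @ \oo --> (0 : R).
Proof.
pose M d := limn (fun n => survival n d).
have Mcvg d : (fun n => survival n d) @ \oo --> M d.
  apply: nonincreasing_is_cvgn.
    by apply/nonincreasing_seqP => n; exact: survival_decr.
  by exists 0 => _ [n _ <-]; have /andP[] := survival_itv n d.
have M0 : M 0%N = 0.
  by apply/cvg_lim => //; under eq_fun do rewrite survival0; exact: cvg_cst.
have MS d : M d.+1 = (M d.+2 + M d) / 2.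
  apply/cvg_lim => //; rewrite -cvg_shiftS/=.
  by apply: cvgM; [apply: cvgD | exact: cvg_cst].
have Mlin d : M d = d%:R * M 1%N.
  suff [] : M d = d%:R * M 1%N /\ M d.+1 = d.+1%:R * M 1%N by [].
  elim: d => [|d [IH1 IH2]]; first by rewrite M0 mul0r mul1r.
  split=> //; have := MS d; rewrite IH1 IH2.
  by rewrite -(natr1 d.+1) -(natr1 d); lra.
have Mitv d : 0 <= M d <= 1.
  apply/andP; split.
    apply: limr_ge; first exact: Mcvg.
    by near=> n; have /andP[] := survival_itv n d.
  apply: limr_le; first exact: Mcvg.
  by near=> n; have /andP[] := survival_itv n d.
suff <- : M 1%N = 0 by exact: Mcvg.
apply/eqP; rewrite eq_le; have /andP[-> _] := Mitv 1%N; rewrite andbT.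
apply/ler_addgt0Pl => e e0; rewrite addr0.
have [d de] : exists d : nat, e^-1 < d%:R.
  by exists (Num.bound e^-1); rewrite archi_boundP// invr_ge0 ltW.
have d0 : 0 < d%:R :> R by rewrite (lt_trans _ de)// invr_gt0.
have := Mitv d; rewrite Mlin => /andP[_].
rewrite mulrC -ler_pdivlMr// mul1r => /le_trans; apply.
by rewrite -[leRHS]invrK lef_pV2 ?posrE ?invr_gt0// ltW.
Unshelve. all: by end_near. Qed.

(** The two halves of [cover n.+1 d.+1] are half-size copies of covers of level
    [n], so the number of intervals obeys the recursion of [survival]. *)
Lemma cover_intervals n d : exists s : seq R,
  (size s)%:R * 2 ^- n = survival n d /\
  cover n d `<=` [set x | exists2 a, a \in s & a <= x <= a + 2 ^- n].
Proof.
elim: n d => [|n IH] [|d].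
- by exists [::]; split; [rewrite mul0r survival0 | move=> x /cover0].
- exists [:: 0]; split; first by rewrite expr0 invr1 mulr1.
  move=> x /cover0S x01; exists 0; first by rewrite inE.
  by rewrite expr0 invr1 add0r.
- by exists [::]; split; [rewrite mul0r survival0 | move=> x /cover0].
have [s [sE sP]] := IH d.+2; have [t [tE tP]] := IH d.
have e2 : (2:R) ^- n.+1 = 2 ^- n / 2 by rewrite exprSr invfM.
exists ([seq a / 2 | a <- s] ++ [seq (a + 1) / 2 | a <- t]); split.
  rewrite size_cat !size_map natrD survivalS -sE -tE e2; lra.
move=> x /coverS[/sP|/tP] [a ain ax].
  exists (a / 2); last by rewrite e2; lra.
  by rewrite mem_cat; apply/orP; left; apply: map_f.
exists ((a + 1) / 2); last by rewrite e2; lra.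
by rewrite mem_cat; apply/orP; right; apply: (map_f (fun a => (a + 1) / 2)).
Qed.

Lemma measure_intervals (s : seq R) (r : R) : 0 <= r ->
  let A := [set x | exists2 a, a \in s & a <= x <= a + r] in
  measurable A /\ (lebesgue_measure A <= ((size s)%:R * r)%:E)%E.
Proof.
move=> r0; elim: s => [|a s [mA IH]] A.
  have -> : A = set0 by rewrite -subset0 => x [].
  by rewrite measure0 mul0r; split; [exact: measurable0 | ].
have -> : A = `[a, a + r]%classic `|`
   [set x | exists2 a, a \in s & a <= x <= a + r].
  apply/seteqP; split=> x.
    move=> [b]; rewrite inE => /orP[/eqP->|bs] bx; last by right; exists b.
    by left; rewrite /= in_itv.
  move=> [|[b bs bx]]; last by exists b => //; rewrite inE bs orbT.
  by rewrite /= in_itv/= => ax; exists a => //; rewrite inE eqxx.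
split; first by apply: measurableU.
apply: (le_trans (measureU2 _ _ _)) => //.
rewrite /= -natr1 mulrDl mul1r addrC EFinD; apply: leeD => //.
rewrite lebesgue_measure_itv/=; case: ifPn => _; last by rewrite lee_fin.
by rewrite -EFinD lee_fin; lra.
Qed.

Lemma measurable_cover n d : measurable (cover n d).
Proof.
exact: (@measurable_realfun.closed_measurable R _ (@closed_cover n d)).
Qed.

Lemma measure_cover n d : (lebesgue_measure (cover n d) <= (survival n d)%:E)%E.
Proof.
have [s [<- sP]] := cover_intervals n d.
have r0 : 0 <= (2:R) ^- n by rewrite invr_ge0 exprn_ge0.
have [mB leB] := measure_intervals s r0.
apply: le_trans leB; apply: le_measure => //; rewrite inE//.
exact: measurable_cover.
Qed.

Lemma measure_cover_cap : lebesgue_measure (\bigcap_n cover n 1) = 0%E.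
Proof.
apply/eqP; rewrite eq_le measure_ge0 andbT.
apply/lee_addgt0Pr => e e0; rewrite add0e.
have [N _ /(_ N (leqnn N)) /=] := cvgr_lt _ survival_cvg0 _ e0.
move: N => n ne.
apply: (@le_trans _ _ (lebesgue_measure (cover n 1))).
  apply: le_measure; rewrite ?inE; last by move=> x; apply.
    by apply: bigcap_measurable => [|k _]; [exists 0%N | exact: measurable_cover].
  exact: measurable_cover.
by apply: (le_trans (measure_cover n 1)); rewrite lee_fin ltW.
Qed.

End dyadic_covers.

(** * Surviving points and binary digits *)
Section digits.
Context {R : realType}.
Local Set Implicit Arguments.
Local Unset Strict Implicit.
Local Unset Printing Implicit Defensive.
Implicit Types (x y : R) (n d : nat) (b : nat -> bool).

Lemma digit_deficit0 b : digit_deficit b 0 = 0.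
Proof. by rewrite /digit_deficit big_ord0 mulr0 subr0. Qed.

Lemma digit_deficitS b j :
  digit_deficit b j.+1 = (1 - 2 * (b 0%N)%:Z) + digit_deficit (b \o S) j.
Proof.
rewrite /digit_deficit big_ord_recl PoszD.
rewrite (eq_bigr (fun i : 'I_j => nat_of_bool ((b \o S) i)))//.
have -> : b (ord0 : 'I_j.+1) = b 0%N by []; lia.
Qed.

Lemma digit_deficit_recr b j :
  digit_deficit b j.+1 = digit_deficit b j + (1 - 2 * (b j)%:Z).
Proof. by rewrite /digit_deficit big_ord_recr PoszD/=; lia. Qed.

Let dsum b := series (fun j => (b j)%:R * 2 ^- j.+1 : R).

Lemma dsumS b n : dsum b n.+1 = ((b 0%N)%:R + dsum (b \o S) n) / 2.
Proof.
rewrite /dsum /series/= big_nat_recl// expr1 mulrDl; congr (_ + _).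
rewrite mulr_suml; apply: eq_bigr => i _ /=.
by rewrite (exprSr _ i.+1) invfM mulrA.
Qed.

Lemma dsum_itv b n : 0 <= dsum b n <= 1.
Proof.
elim: n b => [|n IH] b; first by rewrite /dsum /series/= big_nil lexx ler01.
by rewrite dsumS; have := IH (b \o S); case: (b 0%N) => /=; lra.
Qed.

Lemma binary_expansion_itv b x : binary_expansion b x -> 0 <= x <= 1.
Proof.
move=> bx; have bl : cvgn (dsum b) by apply/cvg_ex; exists x.
rewrite -(cvg_lim _ bx)//; apply/andP; split.
  by apply: limr_ge => //; near=> n; have /andP[] := dsum_itv b n.
by apply: limr_le => //; near=> n; have /andP[] := dsum_itv b n.
Unshelve. all: by end_near. Qed.

Lemma binary_expansion_tail b x :
  binary_expansion b x -> binary_expansion (b \o S) (2 * x - (b 0%N)%:R).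
Proof.
move=> bx; rewrite /binary_expansion -/(dsum (b \o S)).
have -> : dsum (b \o S) = (fun n => 2 * dsum b n.+1 - (b 0%N)%:R).
  by apply/funext => n; rewrite dsumS; lra.
apply: cvgB; last exact: cvg_cst.
by apply: cvgM; [exact: cvg_cst | rewrite (cvg_shiftS (dsum b))].
Qed.

(** Dropping the first digit maps [x] to [2 x - b 0] and moves the height of the
    walk by one, which is the recursion defining [cover]. *)
Lemma cover_digits n d b x : binary_expansion b x ->
  (forall j, 0 < d%:Z + digit_deficit b j) -> cover n d x.
Proof.
elim: n d b x => [|n IH] [|d] b x bx bd.
- by have := bd 0%N; rewrite digit_deficit0.
- by apply/cover0S; exact: binary_expansion_itv bx.
- by have := bd 0%N; rewrite digit_deficit0.
apply/coverS; have := binary_expansion_tail bx.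
case b0: (b 0%N) => tail; [right|left; rewrite subr0 in tail].
- by apply: IH tail _ => j; have := bd j.+1; rewrite digit_deficitS b0; lia.
- by apply: IH tail _ => j; have := bd j.+1; rewrite digit_deficitS b0; lia.
Qed.

Definition alive d x := forall n, cover n d x.

(** Survival for every [n] gives, for each [n], one half in which the walk goes on
    for [n] steps; the covers decrease in [n], so one half serves all of them. *)
Lemma aliveS d x : alive d.+1 x -> alive d.+2 (2 * x) \/ alive d (2 * x - 1).
Proof.
move=> ax; have [?|/existsNP[m nm]] := pselect (alive d.+2 (2 * x)).
  by left.
right=> n; have [h|h] := (coverS _ _ _).1 (ax (maxn m n).+1).
  by exfalso; apply: nm; apply: cover_le h; exact: leq_maxl.
by apply: cover_le h; exact: leq_maxr.
Qed.

(** The digits are found greedily: go to the left half whenever the walk can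
    survive forever there, and to the right half otherwise. *)
Lemma alive_digits d x : alive d x ->
  exists b, binary_expansion b x /\ forall j, 0 < d%:Z + digit_deficit b j.
Proof.
move=> adx.
pose up (s : nat * R) := `[< alive s.1.+1 (2 * s.2) >].
pose step s := if up s then (s.1.+1, 2 * s.2) else (s.1.-1, 2 * s.2 - 1).
pose s n := iter n step (d, x).
pose b n := ~~ up (s n).
have sS n : s n.+1 = step (s n) by [].
have s_alive n : alive (s n).1 (s n).2.
  elim: n => [//|n]; rewrite sS /step /up.
  case: (s n) => -[|k] y /= IH; first by have /cover0 := IH 0%N.
  by case: asboolP => // ny; case: (aliveS IH).
have s_gt0 n : (0 < (s n).1)%N.
  by have := s_alive n; case: (s n) => -[|k] y //= /(_ 0%N) /cover0.
have s_level n : (s n).1%:Z = d%:Z + digit_deficit b n.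
  elim: n => [|n IH]; first by rewrite digit_deficit0 addr0.
  rewrite digit_deficit_recr addrA -IH sS /step /b.
  by have := s_gt0 n; case: (up _) => /=; lia.
have s_rest n : x - dsum b n = 2 ^- n * (s n).2.
  elim: n => [|n IH]; first by
    rewrite /dsum /series/= big_nil subr0 expr0 invr1 mul1r.
  rewrite /dsum seriesSr -/(dsum b) opprD addrA IH sS /step /b exprSr invfM.
  by case: (up _) => /=; lra.
exists b; split; last by move=> j; rewrite -s_level; have := s_gt0 j; lia.
apply/cvgrPdist_le => e e0.
have [N _ ne] := cvgr_le _ pow_half_cvg0 _ e0.
exists N => // n /ne {}ne /=.
rewrite -/(dsum b) s_rest; have /cover_itv /andP[s0 s1] := s_alive n 0%N.
have p0 : 0 <= (2:R) ^- n by rewrite invr_ge0 exprn_ge0.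
rewrite ger0_norm ?mulr_ge0//; apply: le_trans ne.
by rewrite ler_piMr.
Qed.

Lemma OmegaLE : @OmegaL R = alive 1.
Proof.
apply/seteqP; split=> x.
  move=> [_ [b [bx bd]]] n; apply: (cover_digits _ bx) => -[|j].
    by rewrite digit_deficit0.
  by have := bd j.+1 isT; lia.
move=> ax; have [b [bx bd]] := alive_digits ax.
split; first by rewrite in_itv/=; have := cover_itv (ax 0%N).
by exists b; split=> // j _; have := bd j; lia.
Qed.

End digits.

(** * The Takagi function along surviving walks *)
Section takagi_function.
Context {R : realType}.
Local Set Implicit Arguments.
Local Unset Strict Implicit.
Local Unset Printing Implicit Defensive.
Implicit Types (x y t : R) (n d : nat) (m : int).

Lemma distZ_lb t : has_lbound [set `|t - m%:~R| | m in [set: int]].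
Proof. by exists 0 => _ [m _ <-]. Qed.

Lemma distZ_nonempty t : [set `|t - m%:~R| | m in [set: int]] !=set0.
Proof. by exists `|t - 0%:~R|; exists 0. Qed.

Lemma distZ_le t m : distZ t <= `|t - m%:~R|.
Proof. by apply: ge_inf; [exact: distZ_lb | exists m]. Qed.

Lemma distZ_ge0 t : 0 <= distZ t.
Proof. by apply: lb_le_inf; [exact: distZ_nonempty | move=> _ [m _ <-]]. Qed.

Lemma distZ_le1 t : distZ t <= 1.
Proof.
apply: le_trans (distZ_le t (Num.floor t)) _.
have := floor_itv t; rewrite intrD ler_norml; lra.
Qed.

Lemma distZ_nearest t m : `|t - m%:~R| <= 2^-1 -> distZ t = `|t - m%:~R|.
Proof.
move=> tm; apply/eqP; rewrite eq_le distZ_le/=.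
apply: lb_le_inf; first exact: distZ_nonempty.
move=> _ [k _ <-]; have [->//|km] := eqVneq k m.
have : 1 <= `|k%:~R - m%:~R| :> R.
  by rewrite -intrB -intr_norm -[1]/(1%:~R) ler_int; move: km; lia.
have := ler_normB (t - m%:~R) (t - k%:~R).
have -> : t - m%:~R - (t - k%:~R) = k%:~R - m%:~R by ring.
lra.
Qed.

Lemma distZ_periodic t m : distZ (t + m%:~R) = distZ t.
Proof.
congr inf; apply/seteqP; split=> _ [k _ <-].
  by exists (k - m) => //; rewrite intrB; congr `|_|; ring.
by exists (k + m) => //; rewrite intrD; congr `|_|; ring.
Qed.

Let tsum t := series (fun n => 2 ^- n * distZ (2 ^+ n * t)).

Lemma tsum_itv t n : 0 <= tsum t n <= 2 - 2 * 2 ^- n.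
Proof.
elim: n => [|n IH]; first by rewrite /tsum /series/= big_nil expr0 invr1; lra.
rewrite /tsum seriesSr -/(tsum t).
have p0 : 0 <= (2:R) ^- n by rewrite invr_ge0 exprn_ge0.
have := distZ_ge0 (2 ^+ n * t); have := distZ_le1 (2 ^+ n * t).
rewrite exprSr invfM; nra.
Qed.

Lemma is_cvg_tsum t : cvgn (tsum t).
Proof.
apply: nondecreasing_is_cvgn.
  apply/nondecreasing_seqP => n; rewrite /tsum seriesSr lerDl.
  by rewrite mulr_ge0 ?distZ_ge0// invr_ge0 exprn_ge0.
exists 2 => _ [n _ <-]; have := tsum_itv t n.
have : 0 <= (2:R) ^- n by rewrite invr_ge0 exprn_ge0.
lra.
Qed.

Lemma takagi_itv t : 0 <= takagi t <= 2.
Proof.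
apply/andP; split.
  apply: limr_ge; first exact: is_cvg_tsum.
  by near=> n; have /andP[] := tsum_itv t n.
apply: limr_le; first exact: is_cvg_tsum.
near=> n; have := tsum_itv t n.
have : 0 <= (2:R) ^- n by rewrite invr_ge0 exprn_ge0.
rewrite /tsum; lra.
Unshelve. all: by end_near. Qed.

Lemma takagi_double t : takagi t = distZ t + takagi (2 * t) / 2.
Proof.
apply/cvg_lim => //; rewrite -(cvg_shiftS (tsum t)).
have -> : [sequence tsum t n.+1]_n = (fun n => distZ t + tsum (2 * t) n / 2).
  apply/funext => n; rewrite /tsum /series/= big_nat_recl//.
  rewrite expr0 invr1 !mul1r mulr_suml; congr (_ + _).
  apply: eq_bigr => i _; rewrite exprSr invfM -!mulrA; congr (_ * _).
  by rewrite mulrC.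
apply: cvgD; first exact: cvg_cst.
by apply: cvgM; [exact: is_cvg_tsum | exact: cvg_cst].
Qed.

Lemma takagi_periodic t m : takagi (t + m%:~R) = takagi t.
Proof.
congr (limn (series _)); apply/funext => n; congr (_ * _).
rewrite mulrDr -(distZ_periodic (2 ^+ n * t) (2 ^+ n * m)).
by rewrite intrM rmorphXn.
Qed.

Lemma takagi0 : takagi 0 = 0 :> R.
Proof.
have := takagi_double 0; rewrite mulr0 (@distZ_nearest 0 0).
  by rewrite subrr normr0; lra.
by rewrite subrr normr0 invr_ge0.
Qed.

Lemma takagi_left t : 0 <= t <= 2^-1 -> takagi t = t + takagi (2 * t) / 2.
Proof.
move=> t0; rewrite takagi_double (@distZ_nearest t 0).
  by rewrite subr0 ger0_norm//; lra.
by rewrite subr0 ger0_norm; lra.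
Qed.

Lemma takagi_right t : 2^-1 <= t <= 1 ->
  takagi t = 1 - t + takagi (2 * t - 1) / 2.
Proof.
move=> t0; rewrite -[2 * t in RHS](subrK 1) addrK.
rewrite takagi_double (@distZ_nearest t 1).
  have -> : takagi (2 * t) = takagi (2 * t - 1).
    by rewrite -(takagi_periodic (2 * t - 1) 1) subrK.
  by rewrite -normrN opprB ger0_norm//; lra.
by rewrite -normrN opprB ger0_norm; lra.
Qed.

(** Both sides obey the same halving recursion along a surviving walk:
    [takagi] has slope 1 plus its rescaled copy on the left half, slope -1 on the
    right half, and [d] goes to [d + 1], respectively [d - 1].  So the bounded
    discrepancy at level 0 is halved at each surviving step. *)
Lemma cdf_takagi_approx n d x : cover n d x ->
  `|cdf d x - (d%:R * x + takagi x)| <= 3 * 2 ^- n.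
Proof.
elim: n d x => [|n IH] [|d] x; try by move/cover0.
  move=> /cover0S x01; rewrite expr0 invr1 mulr1.
  have := cdf_dist 0 d.+1 x; have := takagi_itv x.
  rewrite /cdfn clamp_id// expr0 invr1 !ler_norml.
  lra.
move=> /coverS[] cx; have := IH _ _ cx; have x01 := cover_itv cx.
  rewrite (@takagi_left x); last lra.
  rewrite (cdfS d x) (@cdf_le0 _ d); last lra.
  by rewrite !ler_norml exprSr invfM -(natr1 d.+1) -(natr1 d); lra.
rewrite (@takagi_right x); last lra.
rewrite (cdfS d x) (@cdf_ge1 _ d.+2); last lra.
by rewrite !ler_norml exprSr invfM -(natr1 d.+1) -(natr1 d); lra.
Qed.

Lemma cdf_takagi d x : alive d x -> cdf d x = d%:R * x + takagi x.
Proof.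
move=> ax; apply/eqP; rewrite -subr_eq0 -normr_le0.
apply/ler_addgt0Pr => e e0; rewrite add0r.
have e3 : 0 < e / 3 by lra.
have [N _ /(_ N (leqnn N)) /=] := cvgr_lt _ pow_half_cvg0 _ e3.
by have := cdf_takagi_approx (ax N); lra.
Qed.

Lemma alive0 d : alive d.+1 (0 : R).
Proof.
move=> n; elim: n d => [|n IH] d; first by apply/cover0S; rewrite lexx ler01.
by apply/coverS; left; rewrite mulr0.
Qed.

Lemma closed_alive d : closed (alive d : set R).
Proof.
have -> : alive d = \bigcap_n cover n d :> set R.
  by apply/seteqP; split=> x h n; [move=> _; exact: h | exact: h].
by apply: closed_bigI => n _; exact: closed_cover.
Qed.

(** The survivors form a closed set, so the supremum of those below [x] is
    attained. *)
Lemma PL_spec x : 0 <= x ->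
  [/\ OmegaL (PL x), PL x <= x & forall z, OmegaL z -> z <= x -> z <= PL x].
Proof.
move=> x0; rewrite /PL.
case: xgetP => [y _ []//|none]; exfalso.
pose A : set R := OmegaL `&` [set z | z <= x].
have A0 : A !=set0 by exists 0; split=> //; rewrite OmegaLE; exact: alive0.
have Aub : has_ubound A by exists x => z [].
have clA : closed A.
  by apply: closedI; [rewrite OmegaLE; exact: closed_alive | exact: closed_le].
have [oA leA] : A (sup A) by apply: clA; exact: closure_sup.
apply: (none (sup A)); split=> // z oz zx.
by apply: ub_le_sup => //; split.
Qed.

Lemma PL_neg x : x < 0 -> PL x = 0.
Proof.
move=> x0; rewrite /PL; case: xgetP => [y _ [oy yx _]|//].
have /cover_itv/andP[y0 _] : cover 0 1 y.
  by move: oy; rewrite OmegaLE => /(_ 0%N).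
by have := le_lt_trans (le_trans y0 yx) x0; rewrite ltxx.
Qed.

Lemma cdf_flat d x y : y <= x -> (forall z, y < z < x -> ~ alive d z) ->
  cdf d x = cdf d y.
Proof.
rewrite le_eqVlt => /predU1P[->//|yx] gap.
have flat z : z \in `]y, x[ -> is_derive z 1 (cdf d) 0.
  by rewrite in_itv/= => /gap /existsNP[n]; exact: is_derive_cdf.
have cont : {within `[y, x], continuous (cdf d)}.
  by apply: continuous_subspaceT; exact: continuous_cdf.
have [c _ /eqP] := MVT yx flat cont.
by rewrite mul0r subr_eq0 => /eqP.
Qed.

Lemma cdf_PL x : 0 <= x -> cdf 1 (PL x) = cdf 1 x.
Proof.
move=> x0; have [_ Px maxP] := PL_spec x0.
apply/esym/cdf_flat => // z /andP[Pz zx] az.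
by have := maxP z; rewrite OmegaLE => /(_ az (ltW zx)); rewrite leNgt Pz.
Qed.

Lemma takagiL_cdf x : takagiL x + x = cdf 1 x.
Proof.
rewrite /takagiL subrK; have [x0|x0] := leP 0 x.
  have [+ _ _] := PL_spec x0; rewrite OmegaLE => aP.
  by rewrite -(cdf_PL x0) (cdf_takagi aP) mul1r addrC.
by rewrite PL_neg// takagi0 add0r cdf_le0// ltW.
Qed.

End takagi_function.

(** * Total variation *)
Section variation.
Context {R : realType}.
Local Set Implicit Arguments.
Local Unset Strict Implicit.
Local Unset Printing Implicit Defensive.
Implicit Types (x y e v : R) (n d k : nat) (f : R -> R) (s : seq R).

Let inc n d k : R := cdf d (k.+1%:R / 2 ^+ n) - cdf d (k%:R / 2 ^+ n).

Lemma inc_ge0 n d k : 0 <= inc n d k.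
Proof.
rewrite subr_ge0; apply: cdf_homo.
by rewrite ler_pM2r ?invr_gt0 ?exprn_gt0// ler_nat.
Qed.

Lemma inc_left n d k : (k < 2 ^ n)%N -> inc n.+1 d.+1 k = inc n d.+2 k / 2.
Proof.
move=> kn; have p0 : 0 < (2 : R) ^+ n by rewrite exprn_gt0.
have half j : (j <= 2 ^ n)%N ->
    cdf d.+1 (j%:R / 2 ^+ n.+1) = cdf d.+2 (j%:R / 2 ^+ n : R) / 2.
  move=> jn; have -> : j%:R / 2 ^+ n.+1 = j%:R / 2 ^+ n / 2 :> R.
    by rewrite exprSr invfM mulrA.
  have j1 : j%:R / 2 ^+ n <= 1 :> R.
    by rewrite ler_pdivrMr// mul1r -natrX ler_nat.
  by rewrite cdfS mulrCA divff// mulr1 (@cdf_le0 _ d) ?addr0// subr_le0.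
by rewrite /inc half// half 1?ltnW// mulrBl.
Qed.

Lemma inc_right n d k : inc n.+1 d.+1 (2 ^ n + k) = inc n d k / 2.
Proof.
have p0 : 0 < (2 : R) ^+ n by rewrite exprn_gt0.
have half j : cdf d.+1 ((2 ^ n + j)%:R / 2 ^+ n.+1) =
    (d.+2%:R + cdf d (j%:R / 2 ^+ n)) / 2 :> R.
  have -> : (2 ^ n + j)%:R / 2 ^+ n.+1 = (1 + j%:R / 2 ^+ n) / 2 :> R.
    by rewrite natrD natrX exprSr invfM mulrA mulrDl divff// gt_eqF.
  rewrite cdfS mulrCA divff// mulr1 (addrC 1) addrK cdf_ge1//.
  by rewrite lerDr divr_ge0// ltW.
by rewrite /inc -addnS !half -mulrBl opprD addrACA subrr add0r.
Qed.

(** The increments of [cdf] over the dyadic grid are halves of those one level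
    coarser, in the left half from height [d + 1] and in the right half from
    height [d - 1], so the sum obeys the recursion of [survival].  The minimum
    counts only the mesh intervals that carry mass. *)
Lemma sum_inc_min n d :
  \sum_(0 <= k < 2 ^ n) Num.min (inc n d k) (2 ^- n) <= survival n d.
Proof.
elim: n d => [|n IH] [|d].
- by rewrite expn0 big_nat1 /inc !cdf0 subrr ge_min lexx.
- by rewrite expn0 big_nat1 expr0 invr1 ge_min lexx orbT.
- by rewrite big1// => k _; rewrite /inc !cdf0 subrr min_l.
have min_half (a c : R) : Num.min (a / 2) (c / 2) = Num.min a c / 2.
  by rewrite -minr_pMl.
have e2 : (2:R) ^- n.+1 = 2 ^- n / 2 by rewrite exprSr invfM.
rewrite (@big_cat_nat _ _ _ (2 ^ n)%N)//; last by rewrite leq_exp2l.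
rewrite survivalS mulrDl; apply: lerD.
  rewrite (eq_big_nat _ _ (F2 := fun k => Num.min (inc n d.+2 k) (2 ^- n) / 2)).
    by rewrite -mulr_suml ler_pM2r.
  by move=> k kn; rewrite inc_left// e2 min_half.
have -> : (2 ^ n.+1 = 2 ^ n + 2 ^ n)%N by rewrite expnS mul2n addnn.
rewrite -{1}[(2 ^ n)%N]add0n big_addn addnK.
under eq_bigr do rewrite addnC inc_right e2 min_half.
by rewrite -mulr_suml ler_pM2r.
Qed.

Lemma variation_grid f (m : nat) : (1 < m)%N ->
  let x k := k%:R / m%:R : R in
  itv_partition (x 1%N) (x m.-1) [seq x k | k <- iota 2 (m - 2)] /\
  variation (x 1%N) (x m.-1) f [seq x k | k <- iota 2 (m - 2)] =
  \sum_(1 <= k < m.-1) `|f (x k.+1) - f (x k)|.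
Proof.
move=> m1 x; set t := [seq x k | k <- iota 2 (m - 2)].
have mE : m.-1 = (m - 2).+1 by lia.
have tE b i : (i < m.-1)%N -> nth b (x 1%N :: t) i = x i.+1.
  case: i => [//|i] im; rewrite /= (nth_map 0%N) ?nth_iota ?size_iota//; lia.
split.
  split; last by rewrite (last_nth 0) size_map size_iota tE -?mE//; lia.
  have lt_iota : path ltn 1 (iota 2 (m - 2)) := iota_ltn_sorted 1 (m - 2).+1.
  rewrite /t path_map; apply: sub_path lt_iota => i j ij /=.
  by rewrite ltr_pM2r ?ltr_nat// invr_gt0 ltr0n; lia.
rewrite /variation size_map size_iota -[1%N]add0n big_addn.
have -> : (m.-1 - 1 = m - 2)%N by lia.
apply: eq_big_nat => i im.
by rewrite /comp !tE ?addn1//; lia.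
Qed.

Lemma open_total_variation_eq f v :
  (forall x0 xn s, 0 < x0 -> x0 < xn -> xn < 1 -> itv_partition x0 xn s ->
    variation x0 xn f s <= v) ->
  (forall e, 0 < e -> exists x0 xn s,
    [/\ 0 < x0, x0 < xn, xn < 1, itv_partition x0 xn s
      & v - e <= variation x0 xn f s]) ->
  open_total_variation 0 1 f = v%:E.
Proof.
move=> ub lb; apply/eqP; rewrite eq_le; apply/andP; split.
  apply: ge_ereal_sup => _ [x0 [xn [s [? ? ? ? ->]]]].
  by rewrite lee_fin; exact: ub.
apply/lee_addgt0Pr => e e0; have [x0 [xn [s [? ? ? ? ve]]]] := lb e e0.
rewrite -leeBlDr// -EFinB; apply: (@le_trans _ _ (variation x0 xn f s)%:E).
  by rewrite lee_fin.
by apply: ereal_sup_ubound; exists x0, xn, s.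
Qed.

Lemma dyadic_small e : 0 < e -> exists n, [/\ (1 < n)%N, 2 ^- n <= e,
  cdf 1 (2 ^- n : R) <= e & survival n 1 <= e].
Proof.
move=> e0.
have cdf_small : (fun n => cdf 1 (2 ^- n : R)) @ \oo --> (0 : R).
  rewrite -(@cdf_le0 _ 1 (0 : R))//.
  by apply: (cvg_comp _ _ pow_half_cvg0); exact: continuous_cdf.
have [n _ /(_ n (leqnn n))] : \forall n \near \oo, [/\ (1 < n)%N, 2 ^- n <= e,
    cdf 1 (2 ^- n : R) <= e & survival n 1 <= e].
  near=> n; split.
  - by near: n; exact: nbhs_infty_gt.
  - by near: n; exact: cvgr_le pow_half_cvg0 _ e0.
  - by near: n; exact: cvgr_le cdf_small _ e0.
  - by near: n; exact: cvgr_le survival_cvg0 _ e0.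
by exists n.
Unshelve. all: by end_near. Qed.

Lemma dyadic_itv n : (1 < n)%N -> 0 < (2 : R) ^- n <= 4^-1.
Proof.
move=> n1; rewrite invr_gt0 exprn_gt0//= lef_pV2 ?posrE ?exprn_gt0//.
have -> : 4 = 2 ^+ 2 :> R by rewrite -natrX.
by rewrite ler_eXn2l// ltr1n.
Qed.

Lemma cdf1_half x : 2^-1 <= x -> cdf 1 x = 1.
Proof.
move=> x2; rewrite cdfS cdf_ge1; last lra.
by rewrite cdf0 addr0 divff.
Qed.

Lemma open_total_variation_cdf : open_total_variation 0 1 (@cdf R 1) = 1%:E.
Proof.
have cdf_in (a b : R) : {in `[a, b] &, nondecreasing_fun (@cdf R 1)}.
  by move=> u w _ _; exact: cdf_homo.
apply: open_total_variation_eq => [x0 xn s x00 x0n xn1 part|e e0].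
  rewrite (nondecreasing_variation (cdf_in _ _) part).
  have := cdf_homo 1 (ltW xn1); have := cdf_homo 1 (ltW x00).
  by rewrite (@cdf_ge1 _ 1 1)// (@cdf_le0 _ 1 0)//; lra.
have [n [n1 _ cn _]] := dyadic_small e0; have := dyadic_itv n1 => n4.
exists (2 ^- n), 2^-1, [:: 2^-1].
have part : itv_partition (2 ^- n : R) 2^-1 [:: 2^-1].
  by apply: itv_partition1; lra.
split=> //; try lra.
rewrite (nondecreasing_variation (cdf_in _ _) part) cdf1_half//; lra.
Qed.

Lemma open_total_variation_opp :
  open_total_variation 0 1 (fun x : R => - x) = 1%:E.
Proof.
have opp_in (a b : R) : {in `[a, b] &, nonincreasing_fun (fun x : R => - x)}.
  by move=> u w _ _; rewrite lerN2.
apply: open_total_variation_eq => [x0 xn s x00 x0n xn1 part|e e0].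
  by rewrite (nonincreasing_variation (opp_in _ _) part); lra.
have e2 : 0 < e / 2 by lra.
have [n [n1 ne _ _]] := dyadic_small e2; have := dyadic_itv n1 => n4.
exists (2 ^- n), (1 - 2 ^- n), [:: 1 - 2 ^- n].
have part : itv_partition (2 ^- n : R) (1 - 2 ^- n) [:: 1 - 2 ^- n].
  by apply: itv_partition1; lra.
split=> //; try lra.
by rewrite (nonincreasing_variation (opp_in _ _) part); lra.
Qed.

(** The increments of [cdf 1] live on intervals of small total length, those of
    the identity mostly elsewhere, so on a fine dyadic grid almost nothing
    cancels. *)
Lemma open_total_variation_cdf_sub_id :
  open_total_variation 0 1 (fun x : R => cdf 1 x - x) = 2%:E.
Proof.
have cdf_in (a b : R) : {in `[a, b] &, nondecreasing_fun (@cdf R 1)}.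
  by move=> u w _ _; exact: cdf_homo.
have opp_in (a b : R) : {in `[a, b] &, nonincreasing_fun (fun x : R => - x)}.
  by move=> u w _ _; rewrite lerN2.
apply: open_total_variation_eq => [x0 xn s x00 x0n xn1 part|e e0].
  apply: (le_trans (variation_le _ _ (cdf 1) (fun x => - x) _)).
  rewrite (nondecreasing_variation (cdf_in _ _) part).
  rewrite (nonincreasing_variation (opp_in _ _) part).
  have := cdf_homo 1 (ltW xn1); have := cdf_homo 1 (ltW x00).
  by rewrite (@cdf_ge1 _ 1 1)// (@cdf_le0 _ 1 0)//; lra.
(* The losses are twice the mesh, the mass of the first interval, and twice
   the sum of minima: five terms in all. *)
have e5 : 0 < e / 5 by lra.
have [n [n1 ne cn sn]] := dyadic_small e5; have := dyadic_itv n1 => n4.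
pose m := (2 ^ n)%N; have m4 : (4 <= m)%N by rewrite (@leq_exp2l 2 2).
pose x k : R := k%:R / m%:R.
have mE : m%:R = 2 ^+ n :> R by rewrite natrX.
have m0 : m%:R != 0 :> R by rewrite mE expf_neq0.
have x1 : x 1%N = 2 ^- n by rewrite /x mE mul1r.
have xm : x m.-1 = 1 - 2 ^- n.
  by rewrite /x -subn1 natrB ?mulrBl ?divff// ?mE ?mul1r//; lia.
have m1 : (1 < m)%N by lia.
have [part varE] := variation_grid (fun y => cdf 1 y - y) m1.
exists (x 1%N), (x m.-1), [seq x k | k <- iota 2 (m - 2)].
split=> //; rewrite ?varE -/x ?x1 ?xm; try lra.
have stepE k : x k.+1 - x k = 2 ^- n.
  by rewrite /x -natr1 mulrDl addrC addKr mE mul1r.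
have incE k : inc n 1 k = cdf 1 (x k.+1) - cdf 1 (x k) by rewrite /inc /x mE.
have sum_min : \sum_(1 <= k < m.-1) Num.min (inc n 1 k) (2 ^- n) <= e / 5.
  apply: le_trans sn; apply: le_trans (sum_inc_min n 1).
  rewrite -/m (@big_cat_nat _ _ _ 1 0 m)//=; last by lia.
  rewrite (@big_cat_nat _ _ _ m.-1 1 m)//=; try lia.
  have min_ge0 k : 0 <= Num.min (inc n 1 k) (2 ^- n).
    by rewrite le_min inc_ge0 invr_ge0 exprn_ge0.
  by rewrite -[leLHS]add0r lerD ?lerDl ?sumr_ge0.
have absE k : `|cdf 1 (x k.+1) - x k.+1 - (cdf 1 (x k) - x k)| =
    (cdf 1 (x k.+1) - cdf 1 (x k)) + (x k.+1 - x k)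
     - 2 * Num.min (inc n 1 k) (2 ^- n).
  have -> : cdf 1 (x k.+1) - x k.+1 - (cdf 1 (x k) - x k) = inc n 1 k - 2 ^- n.
    by rewrite -(stepE k) incE; ring.
  rewrite -incE stepE.
  by case: leP => h; [rewrite ler0_norm | rewrite gtr0_norm]; lra.
rewrite (eq_bigr _ (fun k _ => absE k)) sumrB big_split/= -mulr_sumr.
rewrite !telescope_sumr; try lia.
rewrite x1 xm (@cdf1_half (1 - 2 ^- n)); last lra.
lra.
Qed.

End variation.

Theorem theorem5p4 (R : realType) :
  let fd : R -> R := fun x : R => - x in
  let fu : R -> R := fun x : R => takagiL x + x in
  open_bounded_variation 0 1 (@takagiL R) /\
  minimal_monotone_decomposition 0 1 (@takagiL R) fu fd /\
  {within `[0, 1], continuous fu} /\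
  {within `[0, 1], continuous fd} /\
  singular_on 0 1 fu /\
  (forall x : R, point_of_increase fu x -> OmegaL x) /\
  open_total_variation 0 1 (@takagiL R) = 2%:E /\
  open_total_variation 0 1 fu = 1%:E /\
  open_total_variation 0 1 fd = 1%:E.
Proof.
move=> fd fu.
have fuE : fu = cdf 1 by apply/funext => x; exact: takagiL_cdf.
have tauE : @takagiL R = (fun x : R => cdf 1 x - x).
  by apply/funext => x; rewrite -takagiL_cdf addrK.
have tvL : open_total_variation 0 1 (@takagiL R) = 2%:E.
  by rewrite tauE; exact: open_total_variation_cdf_sub_id.
have tvu : open_total_variation 0 1 fu = 1%:E.
  by rewrite fuE; exact: open_total_variation_cdf.
have tvd : open_total_variation 0 1 fd = 1%:E by exact: open_total_variation_opp.
split; first by rewrite /open_bounded_variation tvL ltry.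
split.
  split; last by rewrite tvL tvu tvd -EFinD.
  split.
  - by move=> x _; rewrite /fu /fd addrK.
  - exists 1; split=> // M M1 x _; rewrite fuE /=.
    by have /andP[c0 c1] := cdf_itv 1 x; rewrite ger0_norm// (le_trans c1)// ltW.
  - by move=> x y _ _; rewrite fuE; exact: cdf_homo.
  - exists 1; split=> // M M1 x; rewrite /= in_itv/= => /andP[x0 x1].
    by rewrite normrN gtr0_norm//; lra.
  - by move=> x y _ _ xy; rewrite lerN2.
split; first by rewrite fuE; apply: continuous_subspaceT; exact: continuous_cdf.
split; first by apply: continuous_subspaceT => x; exact: opp_continuous.
split.
  exists (\bigcap_n cover n 1); split.
  - by apply: bigcap_measurable => [|n _]; [exists 0%N | exact: measurable_cover].
  - exact: measure_cover_cap.
  - move=> x /= nd n _; apply: contrapT => nx; apply: nd => _.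
    by rewrite fuE; exact: is_derive_cdf nx.
split; last by [].
move=> x [/andP[x0 x1] incr]; have [oP Px _] := PL_spec (ltW x0).
move: Px; rewrite le_eqVlt => /predU1P[<-//|Px].
have P0 : 0 <= PL x by case: oP; rewrite in_itv/= => /andP[].
have [] := incr (PL x) 1 _ _ Px x1.
- by rewrite in_itv/= P0/=; lra.
- by rewrite in_itv/= ler01 lexx.
by rewrite fuE (cdf_PL (ltW x0)) ltxx.
Qed.
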